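(* Let $\delta \geq 4$ be an integer. There exist infinitely many Kirkman triple systems with chromatic number $\delta$.
   Context: A Kirkman triple system KTS$(n)$ is a Steiner triple system on $n$ points (every pair in exactly one triple) together with a partition of its triples into parallel classes (partitions of the point set). A $\delta$-colouring maps points to $\delta$ colours with no monochromatic triple; the chromatic number is the least such $\delta$. *)

(* Defs.v *)
From HB Require Import structures.
From mathcomp Require Import all_boot all_order.

Set Implicit Arguments.
Unset Strict Implicit.
Unset Printing Implicit Defensive.

Definition steiner_triple_system (T : finType) (blocks : {set {set T}}) : Prop :=
  (forall B, B \in blocks -> #|B| = 3) /\
  (forall x y : T, x != y ->
     exists! B : {set T}, [/\ B \in blocks, x \in B & y \in B]).

Definition parallel_class (T : finType) (P : {set {set T}}) : Prop :=
  partition P [set: T].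

Definition is_kirkman (T : finType) (blocks : {set {set T}})
    (classes : {set {set {set T}}}) : Prop :=
  [/\ steiner_triple_system blocks,
      partition classes blocks
    & forall P, P \in classes -> parallel_class P].

Record kirkman := Kirkman {
  points : finType;
  triples : {set {set points}};
  classes : {set {set {set points}}};
  kirkmanP : is_kirkman triples classes
}.

(* An isomorphism preserves the resolution as well as the triples. *)
Definition kirkman_iso (K L : kirkman) : Prop :=
  exists f : points K -> points L,
    [/\ bijective f,
        forall B : {set points K}, (f @: B \in triples L) = (B \in triples K)
      & forall P : {set {set points K}},
          ([set f @: B | B : {set points K} in P] \in classes L)
          = (P \in classes K)].

Definition monochromatic (T : finType) (d : nat) (c : T -> 'I_d) (B : {set T}) :=
  exists k : 'I_d, forall x, x \in B -> c x = k.

(* The colouring is not required to use all d colours. *)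
Definition colourable (K : kirkman) (d : nat) : Prop :=
  exists c : points K -> 'I_d,
    forall B, B \in triples K -> ~ monochromatic c B.

Definition chromatic_number_is (K : kirkman) (d : nat) : Prop :=
  colourable K d /\ forall d', colourable K d' -> d <= d'.

(* Main.v *)
Require Import Defs.
From HB Require Import structures.
From mathcomp Require Import all_boot all_order all_fingroup all_algebra zify.
From Stdlib Require Import Classical IndefiniteDescription.

Set Implicit Arguments.
Unset Strict Implicit.
Unset Printing Implicit Defensive.

Import GRing.Theory.
Local Open Scope ring_scope.

(** For every large n we find a Kirkman triple system of chromatic number delta
    on F_3^(n+1) by a discrete intermediate value argument.

    Three KTS(v) on an elementary abelian 3-group G, together with the
    transversal triples whose labels satisfy a + b + c = 0, form a KTS(3v);
    each slice may be labelled by any permutation of G. Without relabelling the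
    iteration yields the affine space, which has no r-colouring once n is large
    (colour focusing: two equally coloured slices G x {v}, G x {w} turn s pairs
    focused at z into s + 1 pairs focused at (z, -v-w)). Shifting the labels of
    one slice by a vector with first coordinate 1 yields instead a system that
    is 3-coloured by the first coordinate.

    Composing the labelling of one slice with a transposition only changes
    triples through two given points. Giving these two points a new colour shows
    that the chromatic number increases by at most 1. Such moves connect the
    3-colourable system to the affine space, so some system on the way has
    chromatic number exactly delta. *)

(** A block is encoded by the operation sending two of its points to the third, made idempotent on
    the diagonal; [cls x y] names the parallel class of the block through [x] and [y]. *)
Record kts (X C : finType) := Kts {
  op : X -> X -> X;
  cls : X -> X -> C;
  opxx : forall x, op x x = x;
  opC : forall x y, op x y = op y x;
  opK : forall x y, op x (op x y) = y;
  clsC : forall x y, x != y -> cls x y = cls y x;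
  cls_op : forall x y, x != y -> cls x (op x y) = cls x y;
  cls_onto : forall x k, exists2 y, x != y & cls x y = k;
  cls_inj : forall x y z, x != y -> x != z -> cls x y = cls x z ->
    z = y \/ z = op x y
}.

Definition kcolourable (X C : finType) (S : kts X C) (d : nat) :=
  exists c : X -> 'I_d, forall x y, x != y ->
    ~ (c x = c y /\ c (op S x y) = c y).

(** * From the algebraic encoding to Kirkman triple systems *)

Section ToKirkman.
Variables (X C : finType) (S : kts X C).
Implicit Types x y z : X.

Lemma op_neql x y : x != y -> x != op S x y.
Proof.
move=> nxy; apply: contraNneq nxy => e.
by rewrite -[y](opK S x) -e opxx.
Qed.

Lemma op_neqr x y : x != y -> y != op S x y.
Proof. by move=> nxy; rewrite opC; apply: op_neql; rewrite eq_sym. Qed.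

Definition block x y := [set x; y; op S x y].

Lemma blockC x y : block x y = block y x.
Proof. by rewrite /block (opC S x y) (setUC [set x]). Qed.

Lemma block_op x y : block x (op S x y) = block x y.
Proof. by rewrite /block opK -!setUA (setUC [set y]). Qed.

Lemma block_pt x y z : x != y -> z \in block x y ->
  exists t, [/\ z != t, block z t = block x y & cls S z t = cls S x y].
Proof.
move=> nxy; rewrite !inE => /orP [/orP [] | ] /eqP ->.
- by exists y.
- by exists x; rewrite blockC clsC 1?eq_sym // eq_sym.
exists x; have n := op_neql nxy; split; first by rewrite eq_sym.
  by rewrite blockC block_op.
by rewrite clsC 1?eq_sym // cls_op.
Qed.

Lemma block_pair x y a b : x != y -> a \in block x y -> b \in block x y ->
  a != b -> block a b = block x y /\ cls S a b = cls S x y.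
Proof.
move=> nxy /(block_pt nxy) [t [nat <- <-]].
rewrite !inE => /orP [/orP [] | ] /eqP ->; rewrite ?eqxx // => _.
by rewrite block_op cls_op.
Qed.

Definition blocks := [set block p.1 p.2 | p : X * X & p.1 != p.2].

Definition pclass k :=
  [set block p.1 p.2 | p : X * X & (p.1 != p.2) && (cls S p.1 p.2 == k)].

Definition pclasses := [set pclass k | k : C].

Lemma blocksP B :
  reflect (exists x y, x != y /\ B = block x y) (B \in blocks).
Proof.
apply: (iffP imsetP) => [[[x y]] | [x [y [nxy ->]]]].
  by rewrite inE /= => nxy ->; exists x, y.
by exists (x, y); rewrite ?inE.
Qed.

Lemma pclassP k B :
  reflect (exists x y, [/\ x != y, cls S x y = k & B = block x y])
          (B \in pclass k).
Proof.
apply: (iffP imsetP) => [[[x y]] | [x [y [nxy <- ->]]]].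
  by rewrite inE /= => /andP [nxy /eqP <-] ->; exists x, y.
by exists (x, y); rewrite ?inE //= nxy eqxx.
Qed.

Lemma blocks_sts : steiner_triple_system blocks.
Proof.
split=> [B /blocksP [x [y [nxy ->]]] | x y nxy].
  by rewrite /block setUC cardsU1 !inE negb_or cards2 nxy
       !(eq_sym (op S x y)) op_neql // op_neqr.
exists (block x y); split.
  by split; rewrite ?inE ?eqxx ?orbT //; apply/blocksP; exists x, y.
move=> _ [/blocksP [u [v [nuv ->]]] xB yB].
by case: (block_pair nuv xB yB nxy).
Qed.

Lemma pclass_parallel k : parallel_class (pclass k).
Proof.
apply/and3P; split.
- apply/eqP/setP=> x; rewrite inE; apply/bigcupP.
  have [y nxy e] := cls_onto S x k.
  by exists (block x y); rewrite ?inE ?eqxx //; apply/pclassP; exists x, y.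
- apply/trivIsetP=> _ _ /pclassP [x [y [nxy exy ->]]]
  /pclassP [u [v [nuv euv ->]]]; apply: contraR => /pred0Pn [z /andP []].
  (* Both blocks are rewritten as blocks generated from the common point [z], where [cls_inj]
     applies. *)
  move=> /(block_pt nxy) [t [nzt <- et]] /(block_pt nuv) [w [nzw <- ew]].
  have [-> | ->] // : w = t \/ w = op S z t.
    by apply: cls_inj; rewrite // et ew exy euv.
  by rewrite block_op.
- apply/negP=> /pclassP [x [y [_ _ /setP /(_ x)]]].
  by rewrite !inE eqxx.
Qed.

Lemma blocks_kirkman (x0 : X) : is_kirkman blocks pclasses.
Proof.
split; first exact: blocks_sts; last first.
  by move=> _ /imsetP [k _ ->]; apply: pclass_parallel.
apply/and3P; split.
- apply/eqP/setP=> B; apply/bigcupP/blocksP.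
    by move=> [_ /imsetP [k _ ->] /pclassP [x [y [nxy _ ->]]]]; exists x, y.
  move=> [x [y [nxy ->]]]; exists (pclass (cls S x y)); first exact: imset_f.
  by apply/pclassP; exists x, y.
- apply/trivIsetP=> _ _ /imsetP [k _ ->] /imsetP [l _ ->].
  apply: contraR => /pred0Pn [_ /andP [/pclassP [x [y [nxy <- ->]]]]].
  move=> /pclassP [u [v [nuv <- e]]].
  have [||//|_ ->] := @block_pair u v x y nuv; last by [].
    by rewrite -e !inE eqxx.
  by rewrite -e !inE eqxx orbT.
(* The base point enters here: [cls_onto] at [x0] puts a block into every class, so none is
   empty. *)
- apply/imsetP=> [[k _ /setP e]].
  have [y nxy ek] := cls_onto S x0 k.
  have /negP[] : block x0 y \notin pclass k by rewrite -(e (block x0 y)) inE.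
  by apply/pclassP; exists x0, y.
Qed.

Definition to_kirkman (x0 : X) := Kirkman (blocks_kirkman x0).

Lemma to_kirkman_colourable x0 d :
  colourable (to_kirkman x0) d <-> kcolourable S d.
Proof.
split=> [] [c cP]; exists c.
  move=> x y nxy [exy exop]; apply: (cP (block x y)).
    by apply/blocksP; exists x, y.
  by exists (c y) => z; rewrite !inE => /orP [/orP [] | ] /eqP ->.
move=> _ /blocksP [x [y [nxy ->]]] [k kP]; apply: (cP x y nxy).
by rewrite !kP ?inE ?eqxx ?orbT.
Qed.

End ToKirkman.

Lemma kcolourable_le (X C : finType) (S : kts X C) d d' :
  (d <= d')%N -> kcolourable S d -> kcolourable S d'.
Proof.
move=> le_d [c cP]; exists (fun x => widen_ord le_d (c x)) => x y nxy.
move=> [/(congr1 val) /= /val_inj e1 /(congr1 val) /= /val_inj e2].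
exact: cP x y nxy (conj e1 e2).
Qed.

(** * Changes confined to the blocks through two points *)

Section Moves.
Variables X C : finType.
Implicit Types S U : kts X C.

(** Parallel classes may change freely, since colourability sees only the blocks. *)
Definition move S U := exists p q, forall x y, x != y ->
  [\/ op U x y = op S x y, p \in [:: x; y; op U x y]
    | q \in [:: x; y; op U x y]].

Inductive moves : kts X C -> kts X C -> Prop :=
| moves_refl S : moves S S
| moves_step S U V : move S U -> moves U V -> moves S V.

Lemma moves_trans S U V : moves S U -> moves U V -> moves S V.
Proof. by elim=> // {}S W U' mSW _ IH /IH; apply: moves_step. Qed.

Lemma move_moves S U : move S U -> moves S U.
Proof. by move=> m; apply: moves_step m (moves_refl _). Qed.

Lemma move_kcolourable S U d :
  move S U -> kcolourable S d -> kcolourable U d.+1.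
Proof.
move=> [p [q mP]] [c cP].
pose A x := (x == p) || (x == q).
exists (fun x => if A x then ord_max else widen_ord (leqnSn d) (c x)).
move=> x y nxy; case: (boolP (A x)) => Ax; case: (boolP (A y)) => Ay.
- case: ifP => Az [_ e].
    (* Three distinct points cannot all lie in the pair [p], [q]. *)
    have := op_neql U nxy; have := op_neqr U nxy.
    move: Ax Ay Az nxy; rewrite /A.
    by do 3!case/orP=> /eqP ->; rewrite ?eqxx.
  by move/(congr1 val): e => /=; have := ltn_ord (c (op U x y)); lia.
- by move=> [/(congr1 val) /=]; have := ltn_ord (c y); lia.
- by move=> [/(congr1 val) /=]; have := ltn_ord (c x); lia.
case: ifP => Az [].
  by move=> _ /(congr1 val) /=; have := ltn_ord (c y); lia.
move=> /(congr1 val) /= /val_inj e1 /(congr1 val) /= /val_inj e2.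
move: Ax Ay Az; rewrite /A.
move=> /norP [xp xq] /norP [yp yq] /norP [zp zq].
case: (mP x y nxy).
- by move=> eop; apply: (cP x y nxy); rewrite -eop.
- by rewrite !inE !(eq_sym p) (negPf xp) (negPf yp) (negPf zp).
- by rewrite !inE !(eq_sym q) (negPf xq) (negPf yq) (negPf zq).
Qed.

(** The first system on the chain that is not [d]-colourable has a [d]-colourable predecessor. *)
Lemma moves_intermediate S U d : moves S U ->
  kcolourable S d -> ~ kcolourable U d ->
  exists V : kts X C, kcolourable V d.+1 /\ ~ kcolourable V d.
Proof.
elim=> // {}S W {}U mSW _ IH cS ncU.
have [cW | ncW] := classic (kcolourable W d); first exact: IH.
by exists W; split=> //; apply: move_kcolourable cS.
Qed.

End Moves.

Lemma I3_ind (P : 'I_3 -> Prop) : P 0 -> P 1 -> P (-1) -> forall i, P i.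
Proof.
move=> P0 P1 P2 [[|[|[|//]]] ilt].
- by rewrite (_ : Ordinal _ = 0) //; apply: val_inj.
- by rewrite (_ : Ordinal _ = 1) //; apply: val_inj.
- by rewrite (_ : Ordinal _ = -1) //; apply: val_inj.
Qed.

Lemma I3_subr (i j : 'I_3) : i != j -> j = i + 1 \/ j = i - 1.
Proof.
by elim/I3_ind: i; elim/I3_ind: j => //= _;
  [left | right | right | left | left | right]; apply: val_inj.
Qed.

(** * Tripling a system over an elementary abelian 3-group *)

Section Triple.
Variables (G : finZmodType) (C : finType).
Hypothesis G3 : forall x : G, x + x + x = 0.

Section Def.
Variables (F : 'I_3 -> kts G C) (q : 'I_3 -> {perm G}).
Local Notation X := (G * 'I_3)%type.
Implicit Types u v w : X.

Definition label u := q u.2 u.1.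

Definition unlabel (x : G) (i : 'I_3) : X := ((q i)^-1%g x, i).

Lemma unlabelK x i : label (unlabel x i) = x.
Proof. by rewrite /label /= permKV. Qed.

Lemma labelK u : unlabel (label u) u.2 = u.
Proof. by case: u => a i; rewrite /unlabel /label /= permK. Qed.

(** The three elements of Z/3 sum to 0, so for [i != j] the remaining slice is [- i - j]. *)
Definition triple_op u v : X :=
  if u.2 == v.2 then (op (F u.2) u.1 v.1, u.2)
  else unlabel (- label u - label v) (- u.2 - v.2).

(* A transversal block with labels a, b, c in slices i, i + 1, i - 1 satisfies
   b - a = c - b = a - c, since a + b + c = 0 and 3 x = 0; this common value is
   its parallel class. *)
Definition triple_cls u v : C + G :=
  if u.2 == v.2 then inl (cls (F u.2) u.1 v.1)
  else inr (if v.2 == u.2 + 1 then label v - label u else label u - label v).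

Lemma third_neq (i j : 'I_3) : i != j -> - i - j != i.
Proof. by elim/I3_ind: i; elim/I3_ind: j. Qed.

Lemma third_third (i j : 'I_3) : - i - (- i - j) = j.
Proof. by rewrite opprB addrC subrK. Qed.

Lemma third_succ (i j : 'I_3) :
  i != j -> (- i - j == i + 1) = ~~ (j == i + 1).
Proof. by elim/I3_ind: i; elim/I3_ind: j. Qed.

Lemma succ_sym (i j : 'I_3) : i != j -> (i == j + 1) = ~~ (j == i + 1).
Proof. by elim/I3_ind: i; elim/I3_ind: j. Qed.

Lemma opp_double (x : G) : - x = x + x.
Proof. by apply/eqP; rewrite eq_sym -addr_eq0 G3. Qed.

Lemma triple_opxx u : triple_op u u = u.
Proof. by rewrite /triple_op eqxx opxx; case: u. Qed.

Lemma triple_opC u v : triple_op u v = triple_op v u.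
Proof.
rewrite /triple_op eq_sym; case: eqP => [-> | _]; first by rewrite opC.
by rewrite (addrC (- label u)) (addrC (- u.2)).
Qed.

Lemma triple_opK u v : triple_op u (triple_op u v) = v.
Proof.
rewrite {2}/triple_op; case: eqVneq => [e | n].
  by rewrite /triple_op /= eqxx opK e; case: v {e}.
rewrite /triple_op /= eq_sym (negPf (third_neq n)) unlabelK third_third.
by rewrite opprB addrC subrK labelK.
Qed.

Lemma slice_neq u v : u != v -> u.2 = v.2 -> u.1 != v.1.
Proof.
by case: u v => a i [b j] /= n e; apply: contraNneq n => ->; rewrite e.
Qed.

Lemma triple_clsC u v : u != v -> triple_cls u v = triple_cls v u.
Proof.
move=> nuv; rewrite /triple_cls (eq_sym v.2 u.2); case: eqVneq => [e | n].
  by rewrite -e clsC // slice_neq.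
by rewrite (succ_sym n); case: eqP.
Qed.

Lemma triple_cls_op u v :
  u != v -> triple_cls u (triple_op u v) = triple_cls u v.
Proof.
move=> nuv; rewrite /triple_op; case: eqVneq => [e | n].
  by rewrite /triple_cls /= -e eqxx cls_op // slice_neq.
rewrite /triple_cls /= (negPf n) [u.2 == _]eq_sym (negPf (third_neq n)).
rewrite third_succ // unlabelK.
congr inr; case: eqP => /= _.
  by rewrite opprB opprK (opp_double (label u)) addrCA.
by rewrite addrAC -opprD -opp_double opprK.
Qed.

Lemma triple_cls_onto u k : exists2 v, u != v & triple_cls u v = k.
Proof.
have n1 : u.2 != u.2 + 1 by elim/I3_ind: u.2.
case: u k n1 => a i [k | d] /= n1.
  have [b nab <-] := cls_onto (F i) a k.
  exists (b, i); last by rewrite /triple_cls /= eqxx.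
  by apply: contra_neq nab => -[].
exists (unlabel (d + label (a, i)) (i + 1)).
  by apply: contra_neq n1 => -[].
by rewrite /triple_cls /= (negPf n1) eqxx unlabelK addrK.
Qed.

Lemma triple_cls_inj u v w : u != v -> u != w ->
  triple_cls u v = triple_cls u w -> w = v \/ w = triple_op u v.
Proof.
move=> nuv nuw; rewrite /triple_cls /triple_op.
case: (eqVneq u.2 v.2) => [ev | nv]; case: (eqVneq u.2 w.2) => [ew | nw] //.
  case=> /(cls_inj (slice_neq nuv ev) (slice_neq nuw ew)) [] e.
    by left; rewrite [w]surjective_pairing e -ew ev -surjective_pairing.
  by right; rewrite [w]surjective_pairing e -ew.
case=> e; have eq_unlabel x k : label w = x -> w.2 = k -> w = unlabel x k.
  by move=> <- <-; rewrite labelK.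
have third : label w = - label u - label v -> w.2 = - u.2 - v.2 ->
    w = unlabel (- label u - label v) (- u.2 - v.2) by apply: eq_unlabel.
have twin : label w = label v -> w.2 = v.2 -> w = v.
  by move=> el es; rewrite (eq_unlabel _ _ el es) labelK.
have uw : label u + label u - label v = - label u - label v.
  by rewrite -(opp_double (label u)).
have pred_succ : (u.2 - 1 == u.2 + 1) = false by elim/I3_ind: u.2.
(* If [v] and [w] share a slice, equal differences give equal labels; otherwise [w] lies in the
   third slice and its label must be [- label u - label v]. *)
have [ev | ev] := I3_subr nv; have [ew | ew] := I3_subr nw;
  rewrite ev ew ?eqxx ?pred_succ in e.
- by left; apply: twin; [apply/esym/(addIr _ e) | rewrite ev].
- right; apply: third;
    last by rewrite ew ev; apply/eqP; elim/I3_ind: (u.2).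
  by rewrite -uw -addrA -opprB e opprB addrC subrK.
- right; apply: third;
    last by rewrite ew ev; apply/eqP; elim/I3_ind: (u.2).
  by rewrite -uw -addrA e addrC subrK.
- by left; apply: twin; [apply/esym/oppr_inj/(addrI _ e) | rewrite ev].
Qed.

Definition triple : kts (G * 'I_3)%type (C + G)%type :=
  Kts triple_opxx triple_opC triple_opK triple_clsC triple_cls_op
      triple_cls_onto triple_cls_inj.

End Def.

Lemma triple_move_label F q i a b :
  move (triple F q) (triple F [eta q with i |-> (tperm a b * q i)%g]).
Proof.
set q' := [eta _ with _ |-> _].
have q'E j c : (c, j) \notin [:: (a, i); (b, i)] -> q' j c = q j c.
  rewrite /q' /= !inE !xpair_eqE; case: (eqVneq j i) => [-> | //].
  by rewrite !andbT negb_or permM => /andP [ca cb]; rewrite tpermD // eq_sym.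
exists (a, i), (b, i) => u v nuv; set w := op _ u v.
have [uA | uA] := boolP (u \in [:: (a, i); (b, i)]).
  by move: uA; rewrite !inE => /orP [] /eqP ->; rewrite eqxx; constructor.
have [vA | vA] := boolP (v \in [:: (a, i); (b, i)]).
  by move: vA; rewrite !inE => /orP [] /eqP ->; rewrite eqxx orbT; constructor.
have [wA | wA] := boolP (w \in [:: (a, i); (b, i)]).
  by move: wA; rewrite !inE => /orP [] /eqP ->; rewrite eqxx !orbT; constructor.
constructor; move: wA; rewrite {}/w /= /triple_op; case: eqP => // _.
have labelE t : t \notin [:: (a, i); (b, i)] -> label q' t = label q t.
  by case: t => c j; apply: q'E.
rewrite !labelE //; set x := - _ - _; set k := - _ - _ => wA.
(* The new third point has the same label under [q] and [q'], hence it is also the old third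
   point. *)
by rewrite -{2}(unlabelK q' x k) labelE // labelK.
Qed.

(** Pointwise equal data need not give equal records, so they are identified by a move that changes
    no block. *)
Lemma triple_eqfun F F' q q' : (forall i x y, op (F i) x y = op (F' i) x y) ->
  q =1 q' -> moves (triple F q) (triple F' q').
Proof.
move=> eF eq; apply: move_moves; exists (0, 0), (0, 0) => u v _; constructor.
by rewrite /= /triple_op /unlabel /label eF !eq.
Qed.

Lemma triple_moves_labels F q i :
  moves (triple F q) (triple F [eta q with i |-> 1%g]).
Proof.
have [ts eq_i _] := prod_tpermP (q i); elim: ts q eq_i => [|t ts IH] q.
  rewrite big_nil => e; apply: triple_eqfun => // j /=.
  by case: eqP => // ->.
rewrite big_cons => e.
apply: moves_step (triple_move_label F q i t.1 t.2) _.
set q' := [eta q with _ |-> _].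
apply: moves_trans (IH q' _) _.
  (* The transposition is an involution and cancels the first factor of [q i]. *)
  by rewrite /q' /= eqxx e mulgA tperm2 mul1g.
by apply: triple_eqfun => // j; rewrite /q' /=; case: eqP.
Qed.

Lemma triple_move_slice F i S U q : move S U ->
  move (triple [eta F with i |-> S] q) (triple [eta F with i |-> U] q).
Proof.
move=> [a [b mP]]; exists (a, i), (b, i) => u v nuv /=.
rewrite /triple_op /=; case: eqVneq => [e | _]; last by constructor.
case: u v e nuv => x j [y _] /= <- nxy.
case: eqVneq => [-> | _]; last by constructor.
have {}nxy : x != y by apply: contra_neq nxy => ->.
case: (mP x y nxy) => [-> | |]; first by constructor.
- by rewrite !inE => e; constructor 2; rewrite !xpair_eqE eqxx !andbT.
- by rewrite !inE => e; constructor 3; rewrite !xpair_eqE eqxx !andbT.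
Qed.

Lemma triple_moves_slice F i S U q : moves S U ->
  moves (triple [eta F with i |-> S] q) (triple [eta F with i |-> U] q).
Proof.
elim=> [{}S | {}S W {}U mSW _ IH]; first exact: moves_refl.
exact: moves_step (triple_move_slice F i q mSW) IH.
Qed.

Lemma triple_moves F F' q : (forall i, moves (F i) (F' i)) ->
  moves (triple F q) (triple F' q).
Proof.
(* Slices are replaced one at a time; [s] lists those already done. *)
move=> mF; pose H (s : seq 'I_3) i := if i \in s then F' i else F i.
have mH i s : moves (triple (H s) q) (triple (H (i :: s)) q).
  have [si | si] := boolP (i \in s).
    apply: triple_eqfun => // j x y; rewrite /H inE.
    by case: eqP => // ->; rewrite si.
  apply: moves_trans (_ : moves (triple [eta H s with i |-> F i] q) _).
    apply: triple_eqfun => // j x y /=; rewrite /H.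
    by case: eqP => // ->; rewrite (negPf si).
  apply: moves_trans (triple_moves_slice (H s) i q (mF i)) _.
  by apply: triple_eqfun => // j x y /=; rewrite /H inE; case: eqP => // ->.
apply: moves_trans (_ : moves (triple (H (enum 'I_3)) q) _); last first.
  by apply: triple_eqfun => // i x y; rewrite /H mem_enum.
elim: (enum _) => [|i s IH]; last exact: moves_trans IH (mH i s).
by apply: triple_eqfun.
Qed.

End Triple.

(** * Affine spaces over F_3 by iterated tripling *)

HB.instance Definition _ (G H : finZmodType) := Finite.on (G * H)%type.

Fixpoint space n : finZmodType :=
  if n is m.+1 then (space m * 'I_3)%type : finZmodType else 'I_3.

(** There are 1 + 3 + ... + 3^n = (3^(n+1) - 1)/2 elements, one for each direction of F_3^(n+1). *)
Fixpoint directions n : finType :=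
  if n is m.+1 then (directions m + space m)%type : finType else unit.

Lemma space3 n (x : space n) : x + x + x = 0.
Proof.
elim: n x => [|n IH] /=; first by elim/I3_ind; apply: val_inj.
by move=> [a i]; congr (_, _); [apply: IH | elim/I3_ind: i; apply: val_inj].
Qed.

Lemma card_space n : #|space n| = (3 ^ n.+1)%N.
Proof.
by elim: n => [|n IH]; rewrite ?card_ord //= card_prod IH card_ord -expnSr.
Qed.

Definition line_op : 'I_3 -> 'I_3 -> 'I_3 := fun x y => - x - y.
Definition line_cls : 'I_3 -> 'I_3 -> unit := fun _ _ => tt.

Lemma line_opxx x : line_op x x = x.
Proof. by elim/I3_ind: x; apply: val_inj. Qed.

Lemma line_opC x y : line_op x y = line_op y x.
Proof. exact: addrC. Qed.

Lemma line_opK x y : line_op x (line_op x y) = y.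
Proof. by rewrite /line_op opprB addrC subrK. Qed.

Lemma line_cls_onto x k : exists2 y, x != y & line_cls x y = k.
Proof. by case: k; exists (x + 1) => //; elim/I3_ind: x. Qed.

Lemma line_cls_inj x y z : x != y -> x != z -> line_cls x y = line_cls x z ->
  z = y \/ z = line_op x y.
Proof.
move=> nxy nxz _.
by elim/I3_ind: x nxy nxz; elim/I3_ind: y => // _; elim/I3_ind: z => // _;
  (by left) || by right; apply: val_inj.
Qed.

Definition line : kts 'I_3 unit :=
  Kts (cls := line_cls) line_opxx line_opC line_opK
      (fun _ _ _ => erefl) (fun _ _ _ => erefl) line_cls_onto line_cls_inj.

Fixpoint affine n : kts (space n) (directions n) :=
  if n is m.+1 return kts (space n) (directions n)
  then triple (@space3 m) (fun _ => affine m) (fun _ => 1%g) else line.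

Lemma affineE n x y : op (affine n) x y = - x - y.
Proof.
elim: n x y => [//|n IH] [a i] [b j] /=; rewrite /triple_op /=.
case: eqVneq => [<- | _].
  by rewrite IH; congr (_, _); elim/I3_ind: i; apply: val_inj.
by rewrite /unlabel /label /= !perm1 invg1 perm1.
Qed.

(** * Colour focusing *)

Definition line_free n r (c : space n -> 'I_r) :=
  forall x y, x != y -> ~ (c x = c y /\ c (- x - y) = c y).

(** This identifies F_3^(n+1) x F_3^(m+1) with F_3^(m+n+2), keeping what colour focusing uses:
    injectivity and compatibility with third points. *)
Lemma space_prod n m : exists h : space n -> space m -> space (m.+1 + n),
  (forall x y v w, h (- x - y) (- v - w) = - h x v - h y w) /\
  (forall x y v w, h x v = h y w -> x = y /\ v = w).
Proof.
elim: m => [|m [h [hB hI]]].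
  by exists (fun x v => (x, v)); split=> // x y v w [].
exists (fun x v => (h x v.1, v.2)); split=> [x y v w | x y [v i] [w j] /=].
  by rewrite hB.
by case=> /hI [-> ->] ->.
Qed.

(** [D] collects the colours of monochromatic pairs focused at [z]; in a line-free colouring the
    colour of [z] is not among them, which supplies one more colour at each step. *)
Lemma focusing r s : exists n, forall c : space n -> 'I_r, line_free c ->
  exists (z : space n) (D : {set 'I_r}), #|D| = s /\
    forall k, k \in D ->
      exists a b, [/\ a != b, c a = k, c b = k & - a - b = z].
Proof.
elim: s => [|s [n IH]].
  by exists 0%N => c _; exists 0, set0; split=> [|k]; rewrite ?cards0 ?inE.
(* There are 3^(m+1) > m slices but only [m] colourings of a slice, so two slices are coloured
   alike. *)
pose m := (r ^ #|space n|)%N; have [h [hB hI]] := space_prod n m.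
exists (m.+1 + n)%N => c cP.
pose slice v := [ffun x : space n => c (h x v)].
have /injectivePn [v [w nvw /ffunP evw]] : ~~ injectiveb slice.
  apply/negP=> /injectiveP /leq_card.
  rewrite card_ffun card_ord card_space -/m leqNgt.
  by rewrite (leq_trans _ (ltn_expl _ _)) // ltnW.
have {}evw x : c (h x v) = c (h x w) by have := evw x; rewrite !ffunE.
have nh x y : h x v != h y w by apply: contra_neq nvw => /hI [].
have opp2 (x : space n) : - x - x = x.
  by apply/eqP; rewrite -opprD eq_sym -addr_eq0 addrA space3.
have opp2m (x : space m) : - x - x = x.
  by apply/eqP; rewrite -opprD eq_sym -addr_eq0 addrA space3.
have c0P : line_free (fun x => c (h x v)).
  move=> x y nxy; have := cP (h x v) (h y v); rewrite -hB opp2m; apply.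
  by apply: contra_neq nxy => /hI [].
have [z [D [<- DP]]] := IH _ c0P.
have czD : c (h z v) \notin D.
  apply/negP=> /DP [a [b [nab ea eb ez]]]; apply: (c0P a b nab).
  by rewrite ea eb ez.
(* The new pair consists of the copies of the old focus in the two slices; each old pair is split
   between them, so every focus becomes [h z (- v - w)]. *)
exists (h z (- v - w)), (c (h z v) |: D); split; first by rewrite cardsU1 czD.
move=> k /setU1P [-> | /DP [a [b [nab ea eb ez]]]].
  by exists (h z v), (h z w); rewrite -hB opp2.
by exists (h a v), (h b w); rewrite -hB ez -evw.
Qed.

Lemma line_free_bound r : exists N, forall n, (N <= n)%N ->
  forall c : space n -> 'I_r, ~ line_free c.
Proof.
have [N NP] := focusing r r.+1; exists N => n /subnK <-.
elim: (n - N)%N => [|m IH] c cP.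
  have [z [D [cD _]]] := NP c cP.
  (* There are not [r + 1] distinct colours available. *)
  by have := max_card (mem D); rewrite cD card_ord ltnn.
(* A line-free colouring restricts to the hyperplane where the last coordinate is 0. *)
apply: (IH (fun x => c (x, 0))) => x y nxy.
have := cP (x, 0) (y, 0).
have -> : - (x, 0) - (y, 0) = (- x - y, 0) :> space (m + N).+1.
  by congr (_, _); apply: val_inj.
by apply; apply: contra_neq nxy => -[].
Qed.

Lemma affine_not_colourable r : exists N, forall n, (N <= n)%N ->
  ~ kcolourable (affine n) r.
Proof.
have [N NP] := line_free_bound r; exists N => n leN [c cP].
by apply: (NP n leN c) => x y nxy; rewrite -affineE; apply: cP.
Qed.

(** * The 3-colourable twisted system and its path to the affine space *)

Fixpoint coord n : space n -> 'I_3 :=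
  if n is m.+1 return space n -> 'I_3 then fun x => coord x.1 else id.

Lemma coordD n (x y : space n) : coord (x + y) = coord x + coord y.
Proof. by elim: n x y => //= n IH x y; rewrite IH. Qed.

Lemma coordN n (x : space n) : coord (- x) = - coord x.
Proof. by elim: n x => //= n IH x; rewrite IH. Qed.

Fixpoint unit_vec n : space n :=
  if n is m.+1 return space n then (unit_vec m, 0) else 1.

Lemma coord_unit_vec n : coord (unit_vec n) = 1.
Proof. by elim: n. Qed.

Definition shift n : {perm space n} := perm (addIr (unit_vec n)).

Definition twist n : 'I_3 -> {perm space n} :=
  [eta (fun=> 1%g) with (-1) |-> shift n].

Fixpoint twisted n : kts (space n) (directions n) :=
  if n is m.+1 return kts (space n) (directions n)
  then triple (@space3 m) (fun _ => twisted m) (twist m) else line.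

Lemma coord_twist n i (x : space n) :
  coord (twist n i x) = coord x + (i == -1)%:R.
Proof.
rewrite /twist /=; case: eqP => _; last by rewrite perm1 addr0.
by rewrite permE coordD coord_unit_vec.
Qed.

(* On a transversal block the labels have coordinates summing to 0, and exactly
   one of the three labels is shifted, so the coordinates of the points sum to
   -1; three equal coordinates sum to 0. *)
Lemma twisted_colourable n : kcolourable (twisted n) 3.
Proof.
exists (@coord n); elim: n => [|n IH].
  by move=> x y /negP nxy [/eqP].
move=> [a i] [b j] /= nab; rewrite /triple_op /=.
case: eqVneq => [eij | nij] /= [eab ec].
  apply: (IH a b _ (conj eab ec)).
  by apply: contra_neq nab => ->; rewrite eij.
set k := - i - j in ec; set t := (twist n k)^-1%g _ in ec.
have := coord_twist k t; rewrite {1}/t permKV coordD !coordN /label /=.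
rewrite !coord_twist ec eab /k; move: nij.
by elim/I3_ind: i {k t ec nab}; elim/I3_ind: j => //=;
  elim/I3_ind: (coord b) => _ /eqP.
Qed.

(** Untwisting the slice [-1] makes all labellings trivial; the slices then become affine by
    induction. *)
Lemma twisted_moves n : moves (twisted n) (affine n).
Proof.
elim: n => [|n IH] /=; first exact: moves_refl.
apply: moves_trans (triple_moves_labels (@space3 n) _ _ (-1)) _.
apply: moves_trans (triple_moves (@space3 n) (F' := fun=> affine n) _ _) _.
  by move=> _; apply: IH.
by apply: triple_eqfun => // i; rewrite /twist /=; case: eqP.
Qed.

Lemma kirkman_iso_card K L : kirkman_iso K L -> #|points K| = #|points L|.
Proof. by move=> [f [/bij_eq_card]]. Qed.

(** * Infinitely many systems with the prescribed chromatic number *)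

Local Open Scope nat_scope.

Theorem theorem5p7 (delta : nat) (hdelta : 4 <= delta) :
  exists K : nat -> kirkman,
    (forall i, chromatic_number_is (K i) delta) /\
    (forall i j, i <> j -> ~ kirkman_iso (K i) (K j)).
Proof.
(* The bound [3 <= d] makes the twisted system [d]-colourable, so the path starts below the
   threshold. *)
have [d e le3d] : exists2 d, delta = d.+1 & (3 <= d)%N.
  by case: delta hdelta => // d; exists d.
have [N NP] := affine_not_colourable d.
have KP i : exists K, chromatic_number_is K delta /\
    #|points K| = (3 ^ (N + i).+1)%N.
  have [S [cS ncS]] := moves_intermediate (twisted_moves (N + i))
    (kcolourable_le le3d (twisted_colourable _)) (NP _ (leq_addr _ _)).
  exists (to_kirkman S 0%R); split; last exact: card_space.
  rewrite e; split; first exact/to_kirkman_colourable.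
  move=> d' /to_kirkman_colourable cd'; rewrite ltnNge; apply/negP=> le_d'.
  exact: ncS (kcolourable_le le_d' cd').
have [K {}KP] := functional_choice _ KP; exists K; split=> [i | i j nij].
  by case: (KP i).
(* Systems with different indices have different powers of 3 as numbers of points. *)
move/kirkman_iso_card; rewrite (KP i).2 (KP j).2 => /eqP.
by rewrite eqn_exp2l // eqSS eqn_add2l => /eqP.
Qed.
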